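(* The quasi-Helmholtz projectors do not depend on the choice of high-order Star matrix. That is, let $\mathcal L\colon \mathbb P(\Gamma,p)\to\mathbb R^{m}$ and $\widetilde{\mathcal L}\colon \mathbb P(\Gamma,p)\to\mathbb R^{\widetilde m}$ be any two injective linear maps, with associated high-order Star matrices $$[\mathbf\Sigma_p]_{i,j}=\big[\mathcal L(\nabla_\Gamma\cdot\psi_i^{(p)})\big]_j,\qquad [\widetilde{\mathbf\Sigma}_p]_{i,j}=\big[\widetilde{\mathcal L}(\nabla_\Gamma\cdot\psi_i^{(p)})\big]_j .$$ Then $$\mathbf\Sigma_p\big(\mathbf\Sigma_p^T\mathbf\Sigma_p\big)^+\mathbf\Sigma_p^T=\widetilde{\mathbf\Sigma}_p\big(\widetilde{\mathbf\Sigma}_p^T\widetilde{\mathbf\Sigma}_p\big)^+\widetilde{\mathbf\Sigma}_p^T,$$ i.e. the projector $\mathbf P_p^{\Sigma}$ is the same for both choices, and consequently so is $\mathbf P_p^{\Lambda H}=\mathbf I-\mathbf P_p^{\Sigma}$.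
   Context: $\Gamma$ is a surface meshed by $C$ triangular cells with $E_{\mathrm{int}}$ internal edges, and $p\ge 0$ is an integer. $\mathbb P(\Gamma,p)$ is the real vector space of functions on $\Gamma$ that are cell-wise polynomials complete up to order $p$ (polynomial of degree at most $p$ on each cell, with no continuity required across cells); its dimension is $M_p=\frac{(p+1)(p+2)}{2}C$. $\{\psi_n^{(p)}\}_{n=1}^{N_p}$ is the set of order-$p$ Graglia-Wilton-Peterson (GWP) basis functions on the mesh, where $N_p=(p+1)E_{\mathrm{int}}+p(p+1)C$. These are real, linearly independent, tangential, div-conforming vector functions, defined as products of the Rao-Wilton-Glisson (RWG) functions (the zeroth-order GWPs, attached to internal edges) with order-$p$ shifted Silvester-Lagrange polynomials. They form a basis of the order-$p$ Nédélec mixed-order div-conforming space on the mesh (the Raviart-Thomas type space with vanishing normal component on boundary edges). $\nabla_\Gamma\cdot$ is the surface divergence, and $\nabla_\Gamma\cdot\psi_n^{(p)}\in\mathbb P(\Gamma,p)$ for every $n$. The same GWP set with the same ordering is used for both Star matrices. $\mathbf A^+$ denotes the Moore-Penrose pseudoinverse of $\mathbf A$. For a high-order Star matrix $\mathbf\Sigma_p$ (a matrix with entries $[\mathbf\Sigma_p]_{i,j}=\big[\mathcal L(\nabla_\Gamma\cdot\psi_i^{(p)})\big]_j$, $1\le i\le N_p$, $1\le j\le m$, for some injective linear map $\mathcal L\colon \mathbb P(\Gamma,p)\to\mathbb R^{m}$), the quasi-Helmholtz projectors are $\mathbf P_p^{\Sigma}=\mathbf\Sigma_p(\mathbf\Sigma_p^T\mathbf\Sigma_p)^+\mathbf\Sigma_p^T$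 and $\mathbf P_p^{\Lambda H}=\mathbf I-\mathbf P_p^{\Sigma}$. *)

(* Defs.v *)
From HB Require Import structures.
From mathcomp Require Import all_boot all_order all_algebra.
From mathcomp Require Import all_classical all_reals all_analysis.
From mathcomp Require Import ring zify.
From mathcomp Require mpoly.
(* The notations of mpoly clash with those of mathcomp-analysis. *)
Import -(notations) mpoly.
Import Order.TTheory GRing.Theory Num.Theory numFieldNormedType.Exports.

Set Implicit Arguments.
Unset Strict Implicit.
Unset Printing Implicit Defensive.

Local Open Scope ring_scope.

(* The library norm of a row vector is the sup norm, hence [enorm]. *)
Definition dot (R : realType) (u v : 'rV[R]_3) : R :=
  \sum_(k < 3) u 0 k * v 0 k.

Definition enorm (R : realType) (u : 'rV[R]_3) : R := Num.sqrt (dot u u).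

(* Indices in 'I_3 are added modulo 3. *)
Definition cross (R : realType) (u v : 'rV[R]_3) : 'rV[R]_3 :=
  \row_(k < 3) (u 0 (k + 1) * v 0 (k + 2) - u 0 (k + 2) * v 0 (k + 1)).

Definition convex_hull_of (R : realType) (n : nat) (v : 'I_n -> 'rV[R]_3)
    (S : {set 'I_n}) : set 'rV[R]_3 :=
  [set x | exists w : 'I_n -> R,
     [/\ forall i, 0 <= w i, \sum_(i in S) w i = 1
       & x = \sum_(i in S) w i *: v i]]%classic.

Record mesh_data (R : realType) := MeshData {
  nvert : nat;
  ncell : nat;
  vertex : 'I_nvert -> 'rV[R]_3;
  cell_vertex : 'I_ncell -> 'I_3 -> 'I_nvert
}.

Section MeshData.
Variables (R : realType) (M : mesh_data R).

Definition corner (c : 'I_(ncell M)) (a : 'I_3) : 'rV[R]_3 :=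
  vertex (cell_vertex c a).

Definition cell_vertices (c : 'I_(ncell M)) : {set 'I_(nvert M)} :=
  [set cell_vertex c a | a : 'I_3].

Definition cell (c : 'I_(ncell M)) : set 'rV[R]_3 :=
  convex_hull_of (@vertex R M) (cell_vertices c).

(* A normal vector, of length twice the area of the cell. *)
Definition cell_normal (c : 'I_(ncell M)) : 'rV[R]_3 :=
  cross (corner c 1 - corner c 0) (corner c 2 - corner c 0).

Definition incident_cells (e : {set 'I_(nvert M)}) : {set 'I_(ncell M)} :=
  [set c | e \subset cell_vertices c].

Definition internal_edges : {set {set 'I_(nvert M)}} :=
  [set e : {set 'I_(nvert M)} | (#|e| == 2) && (#|incident_cells e| == 2)]%N.

(* The two cells contain the vertex [i] and share an edge through it. *)
Definition adjacent_at (i : 'I_(nvert M)) : rel 'I_(ncell M) :=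
  fun c d => let S := cell_vertices c :&: cell_vertices d in
    (i \in S) && (1 < #|S|)%N.

End MeshData.

(* A conforming mesh of flat, nondegenerate triangles whose union is a surface,
   with or without boundary: every edge lies in at most two cells, and the cells
   around a vertex form a single fan. Neither orientability nor connectedness is
   required. *)
Record mesh (R : realType) := Mesh {
  mesh_of :> mesh_data R;
  cell_nondegenerate : forall c : 'I_(ncell mesh_of), cell_normal c != 0;
  cell_vertices_inj : injective (@cell_vertices R mesh_of);
  mesh_conforming : forall c d : 'I_(ncell mesh_of),
    (cell c `&` cell d `<=`
      convex_hull_of (@vertex R mesh_of) (cell_vertices c :&: cell_vertices d))%classic;
  edge_manifold : forall e : {set 'I_(nvert mesh_of)},
    #|e| = 2%N -> (#|incident_cells e| <= 2)%N;
  vertex_manifold : forall (i : 'I_(nvert mesh_of)) (c d : 'I_(ncell mesh_of)),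
    i \in cell_vertices c -> i \in cell_vertices d -> connect (adjacent_at i) c d
}.

(* Functions without continuity across cells are single-valued on the disjoint
   union of the closed cells. *)
Record cell_point (R : realType) (M : mesh R) := CellPoint {
  point_cell : 'I_(ncell M);
  point_pos : 'rV[R]_3;
  point_in_cell : cell point_cell point_pos
}.

(* The restrictions to a plane of the polynomials of R^3 of degree at most [p]
   are the bivariate polynomials of degree at most [p] in any affine coordinates
   of this plane. *)
Definition is_cellwise_poly (R : realType) (M : mesh R) (p : nat) :
    {pred cell_point M -> R} :=
  mem [set f : cell_point M -> R | forall c, exists2 q : mpoly 3 R,
    (msize q <= p.+1)%N &
    forall z, point_cell z = c -> f z = meval (point_pos z 0) q]%classic.
Arguments is_cellwise_poly {R} M p.

Section CellwisePolyClosed.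
Variables (R : realType) (M : mesh R) (p : nat).

Fact is_cellwise_poly_submod : submod_closed (is_cellwise_poly M p).
Proof.
split=> [|k f g].
  by rewrite inE /= => c; exists 0; [rewrite msize0 | move=> z _; rewrite meval0].
rewrite !inE /= => Pf Pg c.
have [[q qp fq] [r rp gr]] := (Pf c, Pg c); exists (k *: q + r).
  rewrite (leq_trans (mmeasureD_le _ _ _)) // geq_max rp andbT.
  exact: leq_trans (msizeZ_le _ _) _.
by move=> z zc; rewrite mevalD mevalZ -(fq z zc) -(gr z zc).
Qed.

HB.instance Definition _ :=
  GRing.isSubmodClosed.Build R (cell_point M -> R) (is_cellwise_poly M p)
    is_cellwise_poly_submod.

End CellwisePolyClosed.

Record cellwise_poly (R : realType) (M : mesh R) (p : nat) := CellwisePoly {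
  cellwise_poly_fun :> cell_point M -> R;
  _ : cellwise_poly_fun \in is_cellwise_poly M p
}.

HB.instance Definition _ (R : realType) (M : mesh R) (p : nat) :=
  [isSub for @cellwise_poly_fun R M p].
HB.instance Definition _ (R : realType) (M : mesh R) (p : nat) :=
  [Choice of cellwise_poly M p by <:].
HB.instance Definition _ (R : realType) (M : mesh R) (p : nat) :=
  [SubChoice_isSubLmodule of cellwise_poly M p by <:].

(* A vector field on the surface, given on each cell by an expression that makes
   sense in the whole space. *)
Definition cell_field (R : realType) (M : mesh R) : Type :=
  'I_(ncell M) -> 'rV[R]_3 -> 'rV[R]_3.

Definition unit_normal (R : realType) (M : mesh R) (c : 'I_(ncell M)) : 'rV[R]_3 :=
  (enorm (cell_normal c))^-1 *: cell_normal c.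

(* div F - n . (DF n), with n the unit normal: only the derivatives of F along
   the cell contribute, so that the value on the cell does not depend on how F
   is extended off the cell. *)
Definition surface_div (R : realType) (M : mesh R) (F : cell_field M) :
    cell_point M -> R :=
  fun z => let n := unit_normal (point_cell z) in
    \sum_(k < 3) 'D_(delta_mx 0 k) (fun x => F (point_cell z) x 0 k) (point_pos z)
    - \sum_(k < 3) n 0 k * 'D_n (fun x => F (point_cell z) x 0 k) (point_pos z).

(* Silvester-Lagrange polynomial: R_i(s, t) = (1 / i!) prod_(0 <= k < i) (s t - k). *)
Definition silvester (R : realType) (s i : nat) (t : R) : R :=
  (\prod_(0 <= k < i) (s%:R * t - k%:R)) / i`!%:R.

(* Shifted Silvester-Lagrange polynomial, for i >= 1:
   R_(i-1)(s, t - 1/s) = (1 / (i-1)!) prod_(1 <= k < i) (s t - k). *)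
Definition shifted_silvester (R : realType) (s i : nat) (t : R) : R :=
  (\prod_(1 <= k < i) (s%:R * t - k%:R)) / i.-1`!%:R.

Section LocalGWP.
Variables (R : realType) (M : mesh R).

(* Barycentric coordinate of the corner [a]: a ratio of signed areas. *)
Definition barycentric (c : 'I_(ncell M)) (a : 'I_3) (x : 'rV[R]_3) : R :=
  dot (cross (corner c (a + 1) - x) (corner c (a + 2) - x)) (cell_normal c)
    / dot (cell_normal c) (cell_normal c).

(* The restriction to the cell [c] of the RWG function of the edge opposite to
   the corner [a]: l / (2 A) (x - corner a), flowing out of [c]. *)
Definition half_rwg (c : 'I_(ncell M)) (a : 'I_3) (x : 'rV[R]_3) : 'rV[R]_3 :=
  (enorm (corner c (a + 1) - corner c (a + 2)) / enorm (cell_normal c))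
    *: (x - corner c a).

(* The interpolation node has barycentric coordinates nu / (p + 2). *)
Definition local_gwp (p : nat) (c : 'I_(ncell M)) (a : 'I_3) (nu : 'I_3 -> nat)
    (x : 'rV[R]_3) : 'rV[R]_3 :=
  (silvester p.+2 (nu a) (barycentric c a x) *
   \prod_(b | b != a) shifted_silvester p.+2 (nu b) (barycentric c b x))
    *: half_rwg c a x.

End LocalGWP.

Section GWP.
Variables (R : realType) (M : mesh R) (p : nat).

Definition internal_edge := {e : {set 'I_(nvert M)} | e \in internal_edges M}.

Definition interior_node :=
  {nu : {ffun 'I_3 -> 'I_p.+3} |
    [forall a, 0 < nu a]%N && (\sum_a nu a == p.+2)%N}.

(* One function for each internal edge and each of its p + 1 nodes, and two
   functions for each cell and each of its p (p + 1) / 2 interior nodes. *)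
Definition gwp_index : Type :=
  (internal_edge * 'I_p.+1) + ('I_(ncell M) * interior_node * 'I_2).

Definition gwp_count : nat :=
  p.+1 * #|internal_edges M| + p * p.+1 * ncell M.

(* The multi-index, in the cell [c], of the [j]-th node of the edge [e]: the
   endpoints carry j + 1 and p + 1 - j, the same on both sides of the edge. *)
Definition edge_node (e : {set 'I_(nvert M)}) (j : 'I_p.+1) (c : 'I_(ncell M))
    (b : 'I_3) : nat :=
  let i := cell_vertex c b in
  if i \notin e then 0%N
  else if [forall k in e, (i <= k)%N] then j.+1 else (p.+1 - j)%N.

(* What the construction leaves free: which of the two cells of an internal edge
   the function flows out of; which of the three (linearly dependent) functions
   of an interior node is dropped; the normalization of the functions; and their
   ordering. *)
Record gwp_basis := GWPBasis {
  plus_cell : internal_edge -> 'I_(ncell M);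
  plus_cell_incident : forall e, plus_cell e \in incident_cells (val e);
  dropped : 'I_(ncell M) -> interior_node -> 'I_3;
  normalization : gwp_index -> R;
  normalization_neq0 : forall t, normalization t != 0;
  gwp_order : 'I_gwp_count -> gwp_index;
  gwp_order_bij : bijective gwp_order
}.

(* In the first case the sum has one term: [a] is the corner opposite to [e]. *)
Definition gwp_field (B : gwp_basis) (t : gwp_index) : cell_field M :=
  match t with
  | inl (e, j) => fun c x =>
      if c \in incident_cells (val e) then
        (-1) ^+ (c != plus_cell B e) *:
          \sum_(a | cell_vertex c a \notin val e)
            local_gwp p c a (edge_node (val e) j c) x
      else 0
  | inr (c0, nu, k) => fun c x =>
      if c == c0 then
        local_gwp p c (lift (dropped B c nu) k) (fun b => val nu b) x
      else 0
  end.

Definition gwp (B : gwp_basis) (n : 'I_gwp_count) : cell_field M :=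
  fun c x => normalization B (gwp_order B n) *: gwp_field B (gwp_order B n) c x.

End GWP.

Section PolynomialFunctions.
Variable R : realType.
Implicit Types (f g : 'rV[R]_3 -> R) (q : mpoly 3 R) (x v : 'rV[R]_3).

Definition polyfun (d : nat) f :=
  exists2 q : mpoly 3 R, (msize q <= d.+1)%N & forall x, f x = meval (x 0) q.

Lemma polyfun_cst d a : polyfun d (fun=> a).
Proof.
exists (mpolyC 3 a) => [|x]; last by rewrite mevalC.
by rewrite mmeasureC; case: (a != 0).
Qed.

Lemma polyfun_coord d k : polyfun d.+1 (fun x => x 0 k).
Proof.
exists (mpolyX R (mnm1 k)) => [|x]; last by rewrite mevalXU.
by rewrite msizeX mdeg1.
Qed.

Lemma eq_polyfun d f g : f =1 g -> polyfun d f -> polyfun d g.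
Proof. by move=> fg [q qd fq]; exists q => // x; rewrite -fg. Qed.

Lemma polyfunD d f g :
  polyfun d f -> polyfun d g -> polyfun d (fun x => f x + g x).
Proof.
move=> [q qd fq] [r rd gr]; exists (q + r) => [|x]; last by rewrite mevalD fq gr.
by rewrite (leq_trans (mmeasureD_le _ _ _)) // geq_max qd.
Qed.

Lemma polyfunM d d' f g :
  polyfun d f -> polyfun d' g -> polyfun (d + d') (fun x => f x * g x).
Proof.
move=> [q qd fq] [r rd gr]; exists (q * r) => [|x]; last by rewrite mevalM fq gr.
have [->|q0] := eqVneq q 0; first by rewrite mul0r msize0.
have [->|r0] := eqVneq r 0; first by rewrite mulr0 msize0.
by rewrite msizeM // -subn1 leq_subLR add1n -addnS -addSn leq_add.
Qed.

Lemma polyfunZ d a f : polyfun d f -> polyfun d (fun x => a * f x).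
Proof. by move/(polyfunM (polyfun_cst 0 a)). Qed.

Lemma polyfunN d f : polyfun d f -> polyfun d (fun x => - f x).
Proof.
by move=> /(polyfunZ (-1)) [q qd fq]; exists q => // x; rewrite -fq mulN1r.
Qed.

Lemma polyfun_sum d (I : Type) (r : seq I) (P : pred I) (F : I -> 'rV[R]_3 -> R) :
  (forall i, P i -> polyfun d (F i)) ->
  polyfun d (fun x => \sum_(i <- r | P i) F i x).
Proof.
move=> FP; elim: r => [|i r IH].
  by apply: (eq_polyfun _ (polyfun_cst d 0)) => x; rewrite big_nil.
case: (boolP (P i)) => [Pi|nPi].
  by apply: (eq_polyfun _ (polyfunD (FP i Pi) IH)) => x; rewrite big_cons Pi.
by apply: (eq_polyfun _ IH) => x; rewrite big_cons (negbTE nPi).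
Qed.

Lemma polyfun_prod (I : Type) (r : seq I) (P : pred I) (d : I -> nat)
    (F : I -> 'rV[R]_3 -> R) :
  (forall i, P i -> polyfun (d i) (F i)) ->
  polyfun (\sum_(i <- r | P i) d i) (fun x => \prod_(i <- r | P i) F i x).
Proof.
move=> FP; elim: r => [|i r IH].
  by apply: (eq_polyfun _ (polyfun_cst _ 1)) => x; rewrite big_nil.
rewrite big_cons; case: (boolP (P i)) => [Pi|nPi].
  by apply: (eq_polyfun _ (polyfunM (FP i Pi) IH)) => x; rewrite big_cons Pi.
by apply: (eq_polyfun _ IH) => x; rewrite big_cons (negbTE nPi).
Qed.

Lemma msize_mderiv k d q : (msize q <= d.+2)%N -> (msize (mderiv k q) <= d.+1)%N.
Proof.
move=> qd; rewrite /mderiv (leq_trans (msize_sum _ _ _)) //.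
rewrite big_seq; apply: (big_ind (fun n => n <= d.+1)%N) => //.
  by move=> m n md nd; rewrite geq_max md.
move=> m mq; case: (posnP (m k)) => [->|mk]; first by rewrite mul0r scale0r msize0.
rewrite (leq_trans (msizeZ_le _ _)) // msizeX.
have: (mdeg m <= d.+1)%N by rewrite -ltnS (leq_trans (msize_mdeg_lt mq)).
have {1}-> : m = mnm_add (mnm_sub m (mnm1 k)) (mnm1 k).
  by rewrite submK //; apply/mnm_lepP => i; rewrite mnm1E; case: eqP => // <-.
by rewrite mdegD mdeg1 addn1.
Qed.

Lemma is_derive_meval q x v :
  is_derive x v (fun y => meval (y 0) q) (\sum_i v 0 i * meval (x 0) (mderiv i q)).
Proof.
pose S q := forall x, is_derive x v (fun y : 'rV[R]_3 => meval (y 0) q)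
  (\sum_i v 0 i * meval (x 0) (mderiv i q)).
have SC a : S (mpolyC 3 a).
  move=> y; under eq_fun do rewrite mevalC.
  rewrite big1; first exact: is_derive_cst.
  by move=> i _; rewrite mderivC meval0 mulr0.
have SX k : S (mpolyX R (mnm1 k)).
  move=> y; under eq_fun do rewrite mevalXU.
  rewrite (bigD1 k) //= big1 => [|i ik].
    have -> : mderiv k (mpolyX R (mnm1 k)) = 1.
      rewrite mderivX mnm1E eqxx scale1r -(mpolyX0 3); congr mpolyX.
      by apply/mnmP => j; rewrite mnmBE subnn mnm0E.
    rewrite addr0 meval1 mulr1.
    have lin : linear (fun z : 'rV[R]_3 => z 0 k : R) by move=> a u w; rewrite !mxE.
    pose f : {linear 'rV[R]_3 -> R} :=
      HB.pack (fun z : 'rV[R]_3 => z 0 k : R) (GRing.isLinear.Build _ _ _ _ _ lin).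
    have fc : continuous f by exact: coord_continuous.
    have df : differentiable f y by exact: linear_differentiable.
    apply: (@DeriveDef _ _ _ y v f); first exact: diff_derivable.
    by rewrite deriveE // diff_lin.
  by rewrite mderivX mnm1E eq_sym (negbTE ik) scale0r meval0 mulr0.
have SD (f g : mpoly 3 R) : S f -> S g -> S (f + g).
  move=> Sf Sg y; under eq_fun do rewrite mevalD.
  apply: (@is_derive_eq _ _ _ _ _ _ _ _ (is_deriveD (Sf y) (Sg y))).
  by rewrite -big_split /=; apply: eq_bigr => i _; rewrite mderivD mevalD mulrDr.
have SM (f g : mpoly 3 R) : S f -> S g -> S (f * g).
  move=> Sf Sg y; under eq_fun do rewrite mevalM.
  apply: (@is_derive_eq _ _ _ _ _ _ _ _ (is_deriveM (Sf y) (Sg y))).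
  rewrite !scaler_sumr -big_split /=; apply: eq_bigr => i _.
  by rewrite mderivM mevalD !mevalM /GRing.scale /=; ring.
suff Sall r : S r by exact: Sall.
elim/mpolyind: r => [|a m r _ _ Sr]; first by rewrite -[0](mpolyC0 3); exact: SC.
apply: SD => //; rewrite -mul_mpolyC; apply: (SM) => //; rewrite mpolyXE_id.
elim/big_ind: _ => [||i _]; [exact: (SC 1) | exact: (SM) |].
by elim: (m i) => [|n IH]; [exact: (SC 1) | rewrite exprS; exact: SM].
Qed.

Lemma polyfun_derive d f v : polyfun d.+1 f -> polyfun d (fun x => 'D_v f x).
Proof.
move=> [q qd fq]; exists (\sum_i v 0 i *: mderiv i q) => [|x].
  rewrite (leq_trans (msize_sum _ _ _)) //; apply/bigmax_leqP => i _.
  by rewrite (leq_trans (msizeZ_le _ _)) // msize_mderiv.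
rewrite (_ : f = fun y => meval (y 0) q); last exact/funext.
have [_ ->] := is_derive_meval q x v.
by rewrite raddf_sum; apply: eq_bigr => i _; rewrite -mevalZ.
Qed.

End PolynomialFunctions.

Section GWPDivergence.
Variables (R : realType) (M : mesh R).

Lemma polyfun_sub d (f g : 'rV[R]_3 -> R) :
  polyfun d f -> polyfun d g -> polyfun d (fun x => f x - g x).
Proof. by move=> Pf /polyfunN; exact: polyfunD. Qed.

Lemma polyfun_cell_barycentric (c : 'I_(ncell M)) a :
  polyfun 1 (barycentric c a).
Proof.
pose N := cell_normal c.
pose u := corner c (a + 1); pose v := corner c (a + 2).
have E : (fun x : 'rV[R]_3 => (dot N N)^-1 * \sum_k N 0 k *
  (((u 0 (k + 1) * v 0 (k + 2) - u 0 (k + 2) * v 0 (k + 1))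
    + (u 0 (k + 2) - v 0 (k + 2)) * x 0 (k + 1))
    + (v 0 (k + 1) - u 0 (k + 1)) * x 0 (k + 2))) =1 barycentric c a.
  move=> x; rewrite /barycentric [RHS]mulrC; congr (_ * _); apply: eq_bigr => k _.
  by rewrite !mxE -/u -/v -/N; ring.
apply: eq_polyfun E _; apply/polyfunZ/polyfun_sum => k _; apply: polyfunZ.
by do !apply: polyfunD; try exact: polyfun_cst; apply: polyfunZ; exact: polyfun_coord.
Qed.

Lemma polyfun_factor (s m i : nat) (f : 'rV[R]_3 -> R) : polyfun 1 f ->
  polyfun (i - m) (fun x => \prod_(m <= k < i) (s%:R * f x - k%:R)).
Proof.
move=> Pf; have -> : (i - m = \sum_(m <= k < i) 1)%N by rewrite sum_nat_const_nat muln1.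
apply: polyfun_prod => k _; apply: polyfun_sub; last exact: polyfun_cst.
exact: polyfunZ.
Qed.

Lemma polyfun_silvester s i (f : 'rV[R]_3 -> R) : polyfun 1 f ->
  polyfun i (fun x => silvester s i (f x)).
Proof.
move=> /(polyfun_factor s 0 i); rewrite subn0 => /polyfunZ Pf.
by apply: eq_polyfun (Pf i`!%:R^-1) => x; rewrite /silvester mulrC.
Qed.

Lemma polyfun_shifted_silvester s i (f : 'rV[R]_3 -> R) : polyfun 1 f ->
  polyfun i.-1 (fun x => shifted_silvester s i (f x)).
Proof.
move=> /(polyfun_factor s 1 i); rewrite subn1 => /polyfunZ Pf.
by apply: eq_polyfun (Pf i.-1`!%:R^-1) => x; rewrite /shifted_silvester mulrC.
Qed.

Lemma polyfun_local_gwp p (c : 'I_(ncell M)) a (nu : 'I_3 -> nat) k :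
  (nu a + \sum_(b | b != a) (nu b).-1 = p)%N ->
  polyfun p.+1 (fun x => local_gwp p c a nu x 0 k).
Proof.
pose Pb b := polyfun_cell_barycentric c b.
move=> nup; have P1 := polyfun_silvester p.+2 (nu a) (Pb a).
have P2 := polyfun_prod (index_enum 'I_3)
  (fun b (_ : b != a) => polyfun_shifted_silvester p.+2 (nu b) (Pb b)).
have P3 := polyfunZ (enorm (corner c (a + 1) - corner c (a + 2)) / enorm (cell_normal c))
  (polyfun_sub (polyfun_coord R 0 k) (polyfun_cst _ (corner c a 0 k))).
move: (polyfunM (polyfunM P1 P2) P3); rewrite nup addn1.
by apply: eq_polyfun => x; rewrite !mxE.
Qed.

Lemma edge_node_degree p (e : {set 'I_(nvert M)}) (j : 'I_p.+1) c a :
  #|e| = 2%N -> e \subset cell_vertices c -> cell_vertex c a \notin e ->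
  (edge_node e j c a + \sum_(b | b != a) (edge_node e j c b).-1 = p)%N.
Proof.
move=> e2 ec aNe; set u := cell_vertex c (a + 1); set v := cell_vertex c (a + 2).
have I3 b : (b == a) || (b == a + 1) || (b == a + 2).
  by case: a b {u v aNe} => [[|[|[|?]]] //= ?] [[|[|[|?]]] //= ?].
have [a1 a2 a12] : [/\ a + 1 != a, a + 2 != a & a + 2 != a + 1].
  by case: a {I3 u v aNe} => [[|[|[|?]]] //= ?].
have sub_uv : e \subset [set u; v].
  apply/fintype.subsetP => i ie; have /imsetP[b _ ib] := fintype.subsetP ec _ ie.
  have ba : b != a by apply: contraNneq aNe => <-; rewrite -ib.
  by rewrite ib !inE; case/orP: (I3 b) => [|/eqP->]; rewrite ?(negbTE ba) ?eqxx ?orbT //= => /eqP->; rewrite eqxx.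
have euv : e = [set u; v].
  by apply/eqP; rewrite eqEcard sub_uv e2 cards2; case: (u != v).
have uv : u != v by move: e2; rewrite euv cards2; case: (u != v).
rewrite /edge_node aNe add0n (bigD1 (a + 1)) //= (bigD1 (a + 2)) /=; last by rewrite a2.
rewrite big1 => [|b /andP[/andP[ba b1] b2]]; last first.
  by move: (I3 b); rewrite (negbTE ba) (negbTE b1) (negbTE b2).
have minE (i i' : 'I_(nvert M)) : i != i' -> [forall k in [set i; i'], (i <= k)%N] = (i < i')%N.
  move=> ii'; rewrite ltn_neqAle (inj_eq val_inj) ii' /=; apply/forall_inP/idP => [|ii k].
    by apply; rewrite !inE eqxx orbT.
  by rewrite !inE => /orP[] /eqP->.
rewrite -/u -/v euv !inE !eqxx orbT /= minE // finset.setUC minE 1?eq_sym //.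
have jp : (j <= p)%N by rewrite -ltnS.
have : (u : nat) != v by rewrite (inj_eq val_inj).
by case: ltngtP => //= _ _; rewrite addn0; lia.
Qed.

Lemma polyfun_gwp p (B : gwp_basis M p) n c k :
  polyfun p.+1 (fun x => gwp B n c x 0 k).
Proof.
rewrite /gwp; set t := gwp_order B n.
suff /(polyfunZ (normalization B t)) : polyfun p.+1 (fun x => gwp_field B t c x 0 k).
  by apply: eq_polyfun => x; rewrite mxE.
have P0 : polyfun p.+1 (fun x : 'rV[R]_3 => (0 : 'rV[R]_3) 0 k).
  by apply: (eq_polyfun _ (polyfun_cst p.+1 0)) => x; rewrite mxE.
case: t => [[e j]|[[c0 nu] i]] /=.
  case: (boolP (c \in _)) => // ce.
  set s := (-1) ^+ _.
  suff /(polyfunZ s) : polyfun p.+1 (fun x => \sum_(a | cell_vertex c a \notin val e)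
      local_gwp p c a (edge_node (val e) j c) x 0 k).
    by apply: eq_polyfun => x; rewrite mxE summxE.
  apply: polyfun_sum => a aNe; apply: polyfun_local_gwp.
  apply: edge_node_degree aNe; last by move: ce; rewrite inE.
  by have := valP e; rewrite inE => /andP[/eqP].
case: eqP => // _; apply: polyfun_local_gwp; set a := lift _ _.
have /andP[/forallP nu0 /eqP] := valP nu; rewrite (bigD1 a) //=.
have -> : (\sum_(b | b != a) val nu b =
    \sum_(b | b != a) (val nu b).-1 + \sum_(b | b != a) 1)%N.
  by rewrite -big_split /=; apply: eq_bigr => b _; rewrite addn1 prednK.
by rewrite sum1_card cardC1 card_ord addnA addn2 => -[].
Qed.

Lemma surface_div_cellwise_poly p (F : cell_field M) :
  (forall c k, polyfun p.+1 (fun x => F c x 0 k)) ->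
  surface_div F \in is_cellwise_poly M p.
Proof.
move=> FP; rewrite inE /= => c; pose n := unit_normal c.
have [] : polyfun p (fun x => \sum_(k < 3) 'D_(delta_mx 0 k) (fun y => F c y 0 k) x
    - \sum_(k < 3) n 0 k * 'D_n (fun y => F c y 0 k) x).
  apply: polyfun_sub; apply: polyfun_sum => k _.
    exact: polyfun_derive.
  by apply: polyfunZ; exact: polyfun_derive.
by move=> q qp qE; exists q => // z zc; rewrite -qE /surface_div zc.
Qed.

End GWPDivergence.

Lemma card_interior_node p : (#|{: interior_node p}| * 2 = p * p.+1)%N.
Proof.
rewrite card_sig; case: p => [|p].
  rewrite mul0n; apply/eqP; rewrite muln_eq0 eqn0Ngt orbF; apply/card_gt0P => -[nu].
  rewrite !inE => /andP[/forallP nu0 /eqP nup].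
  have : (\sum_(a < 3) 1 <= \sum_(a < 3) nu a)%N by apply: leq_sum => a _; exact: nu0.
  by rewrite nup sum1_card card_ord.
pose g (t : 3.-tuple 'I_p.+1) : {ffun 'I_3 -> 'I_p.+4} := [ffun a => inord (tnth t a).+1].
have gE t a : g t a = (tnth t a).+1 :> nat.
  by rewrite ffunE inordK //; have := ltn_ord (tnth t a); lia.
have g_inj : injective g.
  move=> t u gtu; apply: eq_from_tnth => a; apply/val_inj/succn_inj.
  by rewrite -!gE gtu.
have sumE (t : 3.-tuple 'I_p.+1) :
    (\sum_a g t a = \sum_(i <- t) i + 3)%N.
  rewrite big_tuple; under eq_bigr do rewrite gE -addn1.
  by rewrite big_split /= sum1_card card_ord.
have -> : #|[pred nu : {ffun 'I_3 -> 'I_p.+4} | [forall a, 0 < nu a]%N && (\sum_a nu a == p.+3)%N]|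
    = #|g @: [set t : 3.-tuple 'I_p.+1 | (\sum_(i <- t) i)%N == p]|.
  apply: eq_card => nu; rewrite !inE; apply/idP/imsetP => [|[t + ->]].
    move=> /andP[/forallP nu0 /eqP nup].
    have nule a : ((nu a).-1 < p.+1)%N.
      have : (\sum_(b | b != a) 1 <= \sum_(b | b != a) nu b)%N by apply: leq_sum => b _; exact: nu0.
      move: nup; rewrite (bigD1 a) //= sum1_card cardC1 card_ord => /[swap] /=.
      by have := nu0 a; lia.
    pose t := [tuple of mktuple (fun a : 'I_3 => inord (nu a).-1 : 'I_p.+1)].
    have nut : nu = g t.
      by apply/ffunP => a; apply/val_inj; rewrite /= gE tnth_mktuple inordK // prednK.
    exists t => //; rewrite inE; move: nup; rewrite nut sumE => /eqP.
    by rewrite -[p.+3]addn3 eqn_add2r.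
  rewrite inE => /eqP tp; apply/andP; split; last by rewrite sumE tp addn3.
  by apply/forallP => a; rewrite gE.
rewrite (card_imset _ g_inj) card_ord_partitions add2n bin2 muln2 even_halfK.
  exact: mulnC.
by rewrite oddM /=; case: (odd p).
Qed.

Lemma card_gwp_index (R : realType) (M : mesh R) p :
  #|{: gwp_index M p}| = gwp_count M p.
Proof.
rewrite card_sum !card_prod !card_ord card_sig -mulnA card_interior_node.
by rewrite /gwp_count [(_ * p.+1)%N in LHS]mulnC [(ncell M * _)%N]mulnC.
Qed.

Section StarMatrix.
Variables (R : realType) (M : mesh R) (p : nat).

Definition gwp_div (B : gwp_basis M p) (n : 'I_(gwp_count M p)) : cellwise_poly M p :=
  CellwisePoly (surface_div_cellwise_poly (polyfun_gwp B n)).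

(* This is a high-order Star matrix when [L] is linear and injective. *)
Definition star_matrix (B : gwp_basis M p) (m : nat)
    (L : cellwise_poly M p -> 'rV[R]_m) : 'M[R]_(gwp_count M p, m) :=
  \matrix_(i, j) L (gwp_div B i) 0 j.

End StarMatrix.

Definition is_moore_penrose (R : realType) (m n : nat) (A : 'M[R]_(m, n))
    (X : 'M[R]_(n, m)) : Prop :=
  [/\ A *m X *m A = A, X *m A *m X = X,
      (A *m X)^T = A *m X & (X *m A)^T = X *m A].

(* The library function [pinvmx] is not the Moore-Penrose inverse in general. *)
Definition moore_penrose (R : realType) (m n : nat) (A : 'M[R]_(m, n)) : 'M[R]_(n, m) :=
  xget 0 [set X | is_moore_penrose A X]%classic.

Definition projector_Sigma (R : realType) (N m : nat) (S : 'M[R]_(N, m)) : 'M[R]_N :=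
  S *m moore_penrose (S^T *m S) *m S^T.

Definition projector_LambdaH (R : realType) (N m : nat) (S : 'M[R]_(N, m)) : 'M[R]_N :=
  1%:M - projector_Sigma S.

(* Main.v *)
Require Import Defs.
From HB Require Import structures.
From mathcomp Require Import all_boot all_order all_algebra.
From mathcomp Require Import all_classical all_reals all_analysis.
Import Order.TTheory GRing.Theory Num.Theory.

Set Implicit Arguments.
Unset Strict Implicit.
Unset Printing Implicit Defensive.

(** The projector is the orthogonal projector onto the column space of the Star
matrix. This column space is the orthogonal complement of the left kernel, and
when [L] is injective the left kernel consists of the coefficients of the
divergence-free combinations of basis functions, whatever [L] is. *)

Local Open Scope ring_scope.

Section Gram.
Variable R : realFieldType.

(** Each diagonal entry of [A *m A^T] is the sum of the squares of a row of [A]. *)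
Lemma mulmx_tr_eq0 m n (A : 'M[R]_(m, n)) : A *m A^T = 0 -> A = 0.
Proof.
move=> AA0; apply/matrixP => i j; have /matrixP/(_ i i) := AA0; rewrite !mxE.
under eq_bigr do rewrite mxE -expr2.
move=> /eqP; rewrite psumr_eq0 => [|k _]; last exact: sqr_ge0.
by move=> /allP/(_ j (mem_index_enum _)); rewrite sqrf_eq0 => /eqP.
Qed.

Lemma mulmx_gram_eq0 m n q (S : 'M[R]_(m, n)) (U : 'M[R]_(n, q)) :
  S^T *m S *m U = 0 -> S *m U = 0.
Proof.
move=> SSU0; apply/trmx_inj; rewrite trmx0; apply: mulmx_tr_eq0.
by rewrite trmxK trmx_mul -mulmxA [S^T *m _]mulmxA SSU0 mulmx0.
Qed.

Lemma row_free_gram_unitmx m n (A : 'M[R]_(m, n)) :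
  row_free A -> A *m A^T \in unitmx.
Proof.
move=> Afree; rewrite -row_free_unit; apply/row_freeP.
(* With [H := A *m A^T], [H *m pinvmx H *m H = H]. Positivity turns this into
   [(H *m pinvmx H - 1) *m A = 0], where the row-free [A] cancels. *)
exists (pinvmx (A *m A^T)); apply: (row_free_inj Afree); apply/eqP.
rewrite mul1mx -subr_eq0 -[X in _ - X]mul1mx -mulmxBl; apply/eqP/mulmx_tr_eq0.
by rewrite trmx_mul mulmxA -(mulmxA _ A) mulmxBl mul1mx mulmxKpV ?subrr ?mul0mx.
Qed.

(** Duality: the columns of [cokermx T^T], transposed, lie in the left kernel of [T]. The relation
    [<=] compares row spaces, so the transposes make it compare column spaces. *)
Lemma trmx_submx_ker m n q (S : 'M[R]_(m, n)) (T : 'M[R]_(m, q)) :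
  (forall u : 'rV_m, u *m T = 0 -> u *m S = 0) -> (S^T <= T^T)%MS.
Proof.
move=> kerTS; rewrite submxE; apply/eqP/trmx_inj.
rewrite trmx0 trmx_mul trmxK; apply/row_matrixP => i; rewrite row0 row_mul.
apply: kerTS; rewrite -row_mul; apply/trmx_inj.
by rewrite tr_row trmx_mul trmxK mulmx_coker trmx0 col0.
Qed.

End Gram.

Section MoorePenrose.
Variable R : realType.

(** Pseudoinverse from a full-rank factorization: the two products are the orthogonal projectors
    onto the column space of [C] and the row space of [F], hence symmetric. *)
Lemma is_moore_penrose_mul m r n (C : 'M[R]_(m, r)) (F : 'M[R]_(r, n)) :
  row_free C^T -> row_free F ->
  is_moore_penrose (C *m F)
    (F^T *m invmx (F *m F^T) *m invmx (C^T *m C) *m C^T).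
Proof.
move=> Cfree /row_free_gram_unitmx Hu; set H := F *m F^T in Hu *.
have Gu : C^T *m C \in unitmx by rewrite -{2}(trmxK C) row_free_gram_unitmx.
set G := C^T *m C in Gu *; set X := F^T *m _ *m _ *m _.
have Hs : H^T = H by rewrite trmx_mul trmxK.
have Gs : G^T = G by rewrite trmx_mul trmxK.
have AX : C *m F *m X = C *m invmx G *m C^T.
  by rewrite /X !mulmxA -(mulmxA C F) -/H mulmxK.
have XA : X *m (C *m F) = F^T *m invmx H *m F.
  by rewrite /X !mulmxA -(mulmxA _ C^T C) -/G mulmxKV.
split.
- by rewrite AX mulmxA -(mulmxA _ C^T C) -/G mulmxKV.
- by rewrite XA /X !mulmxA -(mulmxA _ F F^T) -/H mulmxKV.
- by rewrite AX !trmx_mul trmxK trmx_inv Gs mulmxA.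
- by rewrite XA !trmx_mul trmxK trmx_inv Hs mulmxA.
Qed.

(** Every matrix has a full-rank factorization, so a pseudoinverse exists and [xget] never returns
    its default 0. *)
Lemma moore_penroseP m n (A : 'M[R]_(m, n)) :
  is_moore_penrose A (moore_penrose A).
Proof.
have Cfree : row_free (col_base A)^T.
  by rewrite /row_free mxrank_tr; exact: col_base_full.
have := is_moore_penrose_mul Cfree (row_base_free A).
by rewrite mulmx_base => AX; exact: (xgetPex 0 (ex_intro _ _ AX)).
Qed.

Lemma projector_Sigma_id N m (S : 'M[R]_(N, m)) : projector_Sigma S *m S = S.
Proof.
have [SXS _ _ _] := moore_penroseP (S^T *m S).
(* With [X] the pseudoinverse, [S^T *m S] kills [X *m S^T *m S - 1] by the first Penrose equation;
   hence so does [S]. *)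
apply/eqP; rewrite -subr_eq0 -{3}(mulmx1 S) /projector_Sigma -!mulmxA -mulmxBr.
by apply/eqP/mulmx_gram_eq0; rewrite mulmxBr mulmx1 [X in X - _]mulmxA SXS subrr.
Qed.

Lemma projector_Sigma_sym N m (S : 'M[R]_(N, m)) :
  (projector_Sigma S)^T = projector_Sigma S.
Proof.
(* The left side is symmetric whatever the projector is. *)
have PPT : projector_Sigma S *m (projector_Sigma S)^T = projector_Sigma S.
  by rewrite {1}/projector_Sigma -(mulmxA _ S^T) -trmx_mul projector_Sigma_id.
by rewrite -[LHS](congr1 trmx PPT) trmx_mul trmxK PPT.
Qed.

Lemma projector_Sigma_mul N m m' (S : 'M[R]_(N, m)) (T : 'M[R]_(N, m')) :
  (S^T <= T^T)%MS -> projector_Sigma T *m projector_Sigma S = projector_Sigma S.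
Proof.
(* [S = T *m D^T], so the projector of [T] fixes [S], the leftmost factor of the projector of
   [S]. *)
move=> /submxP[D /(congr1 trmx)]; rewrite trmx_mul !trmxK => SE.
by rewrite [projector_Sigma S]/projector_Sigma !mulmxA {1}SE mulmxA
  projector_Sigma_id -SE.
Qed.

Lemma eq_projector_Sigma N m m' (S : 'M[R]_(N, m)) (T : 'M[R]_(N, m')) :
  (S^T <= T^T)%MS -> (T^T <= S^T)%MS -> projector_Sigma S = projector_Sigma T.
Proof.
move=> /projector_Sigma_mul TS /projector_Sigma_mul ST.
(* Transposing [ST] reverses its product, which becomes that of [TS]. *)
by rewrite -TS -[RHS]projector_Sigma_sym -[in RHS]ST trmx_mul !projector_Sigma_sym.
Qed.

End MoorePenrose.

Section StarKernel.
Variables (R : realType) (M : mesh R) (p : nat) (B : gwp_basis M p).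

Lemma mul_star_matrix m (L : {linear cellwise_poly M p -> 'rV[R]_m}) u :
  u *m star_matrix B L = L (\sum_i u 0 i *: gwp_div B i).
Proof.
rewrite linear_sum mulmx_sum_row; apply: eq_bigr => i _.
by rewrite linearZ; congr (_ *: _); apply/rowP => j; rewrite !mxE.
Qed.

Lemma star_matrix_submx m m' (L : {linear cellwise_poly M p -> 'rV[R]_m})
    (L' : {linear cellwise_poly M p -> 'rV[R]_m'}) :
  injective L' -> ((star_matrix B L)^T <= (star_matrix B L')^T)%MS.
Proof.
move=> L'_inj; apply: trmx_submx_ker => u; rewrite !mul_star_matrix.
(* Injectivity of [L'] makes the combination of divergences itself vanish, so [L] sends it to 0. *)
by rewrite -(linear0 L') => /L'_inj->; rewrite linear0.
Qed.

End StarKernel.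

Unset Implicit Arguments.

Theorem corollary1 (R : realType) (M : mesh R) (p : nat) (B : gwp_basis M p)
    (m m' : nat)
    (L : {linear cellwise_poly M p -> 'rV[R]_m})
    (L' : {linear cellwise_poly M p -> 'rV[R]_m'})
    (L_inj : injective L) (L'_inj : injective L') :
  projector_Sigma (star_matrix B L) = projector_Sigma (star_matrix B L') /\
  projector_LambdaH (star_matrix B L) = projector_LambdaH (star_matrix B L').
Proof.
have PP : projector_Sigma (star_matrix B L) = projector_Sigma (star_matrix B L').
  by apply: eq_projector_Sigma; exact: star_matrix_submx.
by rewrite /projector_LambdaH PP.
Qed.
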